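(* Let $n$ and $k$ be integers with $n\ge 2k+1$ and $k\ge 2$. Then the total mutual-visibility number of the Kneser graph $KG(n,k)$ is $$\mu_{\rm t}(KG(n,k))=\begin{cases} 0 & \text{if } 2k+1\le n\le 3k-1,\\ \binom{n}{k}-C^*(n,k) & \text{if } 3k\le n\le 2k^2-1,\\ \binom{n}{k}-2k & \text{if } 2k^2\le n,\end{cases}$$ where $C^*(n,k)=C(n,n-k,2k-1)$ is a covering number.
   Context: Kneser graph: $KG(n,k)$ has as vertices the $k$-element subsets of $[n]=\{1,\dots,n\}$; two vertices $A,B$ are adjacent if and only if $A\cap B=\emptyset$. (For $n\ge 2k+1$ it is connected.) Total mutual-visibility: Let $G$ be a connected graph and $\mathcal X\subseteq V(G)$. Two vertices $u,v\in V(G)$ are $\mathcal X$-visible if there is a shortest $u,v$-path $P$ in $G$ with no internal vertex in $\mathcal X$, i.e. $V(P)\cap\mathcal X\subseteq\{u,v\}$. The set $\mathcal X$ is a total mutual-visibility set if any two vertices of $V(G)$ are $\mathcal X$-visible. The total mutual-visibility number $\mu_{\rm t}(G)$ is the largest cardinality of a total mutual-visibility set in $G$. Covering number: For positive integers $n\ge m\ge t$, $C(n,m,t)$ is the minimum number of blocks in a collection $\mathcal B$ of $m$-element subsets (blocks) of an $n$-element set $X$ such that every $t$-element subset of $X$ is contained in at least one block of $\mathcal B$. *)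

(* Defs.v *)
From mathcomp Require Import all_boot.
From mathcomp Require Import boolp.

Set Implicit Arguments.
Unset Strict Implicit.
Unset Printing Implicit Defensive.

(* A finite simple graph is given by its vertex type [V] and its adjacency
   relation [e : rel V]. *)

(* A path from [u] to [v] has vertex sequence [u :: p], hence length [size p]. *)
Definition graph_path (V : finType) (e : rel V) (u v : V) (p : seq V) : Prop :=
  [/\ path e u p, last u p = v & uniq (u :: p)].

Definition shortest_path (V : finType) (e : rel V) (u v : V) (p : seq V)
    : Prop :=
  graph_path e u v p /\
  forall q : seq V, graph_path e u v q -> size p <= size q.

Definition visible (V : finType) (e : rel V) (X : {set V}) (u v : V) : Prop :=
  exists p : seq V,
    shortest_path e u v p /\ [set w in u :: p] :&: X \subset [set u; v].

Definition total_mutual_visibility_set (V : finType) (e : rel V) (X : {set V})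
    : Prop :=
  forall u v : V, visible e X u v.

(* Only meaningful when [e] is connected: otherwise no set, not even [set0],
   is a total mutual-visibility set, and the maximum below is over nothing. *)
Definition total_mutual_visibility_number (V : finType) (e : rel V) : nat :=
  \max_(X : {set V} | `[< total_mutual_visibility_set e X >]) #|X|.

(* The ground set {1, ..., n} is represented by ['I_n]. *)
Definition kneser_vertex (n k : nat) : finType :=
  {A : {set 'I_n} | #|A| == k}.

(* Irreflexive as soon as [0 < k]. *)
Definition kneser_adj (n k : nat) : rel (kneser_vertex n k) :=
  fun A B => val A :&: val B == set0.

Definition is_covering (n m t : nat) (B : {set {set 'I_n}}) : bool :=
  [forall D in B, #|D| == m] &&
  [forall T : {set 'I_n}, (#|T| == t) ==> [exists D in B, T \subset D]].

(* For [t <= m <= n] the family of all [m]-subsets is a covering, so it is a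
   legitimate starting point for the [arg min]. *)
Definition covering_number (n m t : nat) : nat :=
  #|[arg min_(B < [set D : {set 'I_n} | #|D| == m] | is_covering m t B) #|B|]|.

(* Main.v *)
Require Import Defs.
From mathcomp Require Import all_boot.
From mathcomp Require Import boolp.
From mathcomp Require Import zify.

(** In a Kneser graph, the common neighbours of two vertices [A] and [B] are the
    [k]-sets contained in the complement of [A :|: B], and if [A] and [B] are
    distinct and not disjoint, then their shortest paths go through exactly
    these common neighbours, as soon as there is one.  Moreover the unions of
    two such vertices are easy to describe: every set with more than [k] and
    fewer than [2k] elements is one ([kneser_union]).

    If [n <= 3k - 1], any vertex [C] has a complement of size between [k + 1]
    and [2k - 1], which is therefore [A :|: B] with [A] and [B] as above.  Then
    [C] is the only common neighbour of [A] and [B], so no total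
    mutual-visibility set contains [C]: only the empty set can be one
    ([tmv_number_eq0]).

    If [n >= 3k - 1], the complement of [A :|: B] always has room for a
    [k]-set, so the graph has diameter at most 2, and [X] is a total
    mutual-visibility set iff each [A :|: B] has a [k]-set in its complement
    that is not in [X].  Since [A :|: B] may be any [(2k - 1)]-set, this means
    that the complements of the [k]-sets outside [X] form a covering of the
    [(2k - 1)]-sets by [(n - k)]-sets ([tmv_covering]).  A largest [X] thus
    corresponds to a smallest covering ([tmv_number_covering]).

    Finally, passing to complements, such a covering is a family of [k]-sets
    that no [(2k - 1)]-set meets entirely.  With at most [2k - 1] members, a
    family is met by choosing a point in each member; on the other hand [2k]
    pairwise disjoint [k]-sets cannot be met by fewer than [2k] points, and they
    exist when [n >= 2k^2].  Hence the covering number is then [2k]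
    ([covering_number_disjoint]). *)

Set Implicit Arguments.
Unset Strict Implicit.
Unset Printing Implicit Defensive.

(** * Finite sets *)

Lemma exists_set_between (T : finType) (A C : {set T}) (m : nat) :
  A \subset C -> #|A| <= m <= #|C| ->
  exists B : {set T}, [/\ A \subset B, B \subset C & #|B| = m].
Proof.
move=> sAC /andP[leAm lemC].
have cD : #|C :\: A| = #|C| - #|A| by rewrite cardsDS.
have /card_geqP[s [us szs ss]] : m - #|A| <= #|C :\: A| by rewrite cD leq_sub2r.
exists (A :|: [set:: s]); split; first exact: subsetUl.
  rewrite subUset sAC; apply/subsetP=> x; rewrite inE => /ss.
  by rewrite inE => /andP[].
have As0 : A :&: [set:: s] = set0.
  apply/setP=> x; rewrite !inE andbC; apply/negP=> /andP[/ss].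
  by rewrite inE => /andP[/negbTE->].
by rewrite cardsU As0 cards0 subn0 cardsE (card_uniqP us) szs subnKC.
Qed.

(** * Visibility at distance two *)

Section Distance2.

Variables (V : finType) (e : rel V).
Implicit Types (X : {set V}) (u v w : V).

Lemma visible_refl X u : visible e X u u.
Proof.
exists [::]; split; first by split=> [|q _]; [split | exact: leq0n].
by apply/subsetP=> x; rewrite !inE => /andP[->].
Qed.

Lemma visible_adj X u v : u != v -> e u v -> visible e X u v.
Proof.
move=> uv euv; exists [:: v]; split.
  split=> [|q [_ lq _]]; first by split; rewrite //= ?euv // inE uv.
  by case: q lq => //= eq_uv; rewrite eq_uv eqxx in uv.
by apply/subsetP=> x; rewrite !inE => /andP[].
Qed.

Lemma shortest_path2 u v w :
  u != v -> ~~ e u v -> e u w -> e w v -> shortest_path e u v [:: w; v].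
Proof.
move=> uv neuv euw ewv; split.
  split; rewrite //= ?euw ?ewv // !inE negb_or uv !andbT.
  apply/andP; split; apply: contraNneq neuv; first by move=> ->.
  by move=> <-.
move=> [|x [|y q]] [/= pq lq _] //; first by rewrite lq eqxx in uv.
by move: pq; rewrite lq (negbTE neuv).
Qed.

(** A common neighbour bounds the length of shortest paths by two, so a shortest
    path has exactly one internal vertex, which is a common neighbour. *)
Lemma visible_dist2 X u v :
    u != v -> ~~ e u v -> (exists w, e u w && e w v) ->
  visible e X u v <-> exists w, [/\ e u w, e w v & w \notin X].
Proof.
move=> uv neuv [w0 /andP[euw0 ew0v]]; split=> [[p [[[pp lp up] minp] sub]]|].
  have [p0 _] := shortest_path2 uv neuv euw0 ew0v.
  have {minp p0} := minp _ p0.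
  case: p pp lp up sub => [|x [|y [|z p]]] //=.
  - by move=> _ eq_uv; rewrite eq_uv eqxx in uv.
  - by move=> + eq_xv; rewrite eq_xv (negbTE neuv).
  move=> /and3P[eux exy _] eq_yv; subst y.
  rewrite !inE => /and3P[/norP[neq_ux _] neq_xv _] sub _.
  exists x; split=> //; apply/negP=> xX; move/subsetP/(_ x): sub.
  by rewrite !inE xX eqxx orbT eq_sym (negbTE neq_ux) (negbTE neq_xv) => /(_ isT).
move=> [w [euw ewv wX]]; exists [:: w; v]; split; first exact: shortest_path2.
apply/subsetP=> x; rewrite !inE => /andP[/or3P[->|/eqP->|->]] //.
  by rewrite (negbTE wX).
by rewrite orbT.
Qed.

Lemma tmv_diameter2 X :
    (forall u v, u != v -> ~~ e u v -> exists w, e u w && e w v) ->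
  total_mutual_visibility_set e X <->
  forall u v, u != v -> ~~ e u v -> exists w, [/\ e u w, e w v & w \notin X].
Proof.
move=> diam; split=> [tmv u v uv neuv | h u v].
  exact/(visible_dist2 _ uv neuv (diam _ _ uv neuv)).
have [-> | uv] := eqVneq u v; first exact: visible_refl.
have [/(visible_adj X uv)// | neuv] := boolP (e u v).
by apply/(visible_dist2 _ uv neuv (diam _ _ uv neuv)); exact: h.
Qed.

End Distance2.

(** * Coverings *)

Lemma is_coveringP (n m t : nat) (B : {set {set 'I_n}}) :
  reflect ((forall D, D \in B -> #|D| = m) /\
           (forall T : {set 'I_n}, #|T| = t -> exists2 D, D \in B & T \subset D))
          (is_covering m t B).
Proof.
apply: (iffP andP) => [] [hm ht]; split.
- by move=> D DB; apply/eqP; move/forall_inP: hm; apply.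
- move=> T cT; move/forallP/(_ T): ht; rewrite cT eqxx /=.
  by case/exists_inP=> D; exists D.
- by apply/forall_inP=> D DB; apply/eqP/hm.
- apply/forallP=> T; apply/implyP=> /eqP cT; apply/exists_inP.
  by have [D DB sTD] := ht T cT; exists D.
Qed.

Lemma covering_card_le (n m t : nat) (B : {set {set 'I_n}}) (T : {set 'I_n}) :
  t <= n -> is_covering m t B -> #|T| <= t -> exists2 D, D \in B & T \subset D.
Proof.
move=> tn /is_coveringP[_ ht] cT.
have [|T' [sTT' _ /ht[D DB sT'D]]] := @exists_set_between _ T setT t (subsetT T).
  by rewrite cT cardsT card_ord.
by exists D => //; exact: subset_trans sT'D.
Qed.

Lemma covering_number_min (n m t : nat) : t <= m <= n ->
  (exists2 B : {set {set 'I_n}}, is_covering m t B & #|B| = covering_number n m t)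
  /\ (forall B : {set {set 'I_n}},
        is_covering m t B -> covering_number n m t <= #|B|).
Proof.
move=> /andP[tm mn].
have covering_all : is_covering m t [set D : {set 'I_n} | #|D| == m].
  apply/is_coveringP; split=> [D|T cT]; first by rewrite inE => /eqP.
  have [|D [sTD _ cD]] := @exists_set_between _ T setT m (subsetT T).
    by rewrite cT tm cardsT card_ord.
  by exists D => //; rewrite inE cD.
rewrite /covering_number; case: arg_minnP => // B covB minB.
by split; first exists B.
Qed.

(** Choosing one point outside each block gives a set that no block contains,
    so it must have more than [t] points. *)
Lemma covering_card_gt (n m t : nat) (B : {set {set 'I_n}}) :
  t <= n -> m < n -> is_covering m t B -> t < #|B|.
Proof.
move=> tn mn covB; rewrite ltnNge; apply/negP=> Bt.
have /is_coveringP[cB _] := covB.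
have outside D : D \in B -> exists x, x \notin D.
  move=> /cB cD; apply/existsP; rewrite -negb_forall; apply/negP=> /forallP allD.
  have DT : D = setT by apply/setP=> x; rewrite inE allD.
  by move: cD; rewrite DT cardsT card_ord; lia.
have n0 : 0 < n by exact: leq_ltn_trans mn.
pose f (D : {set 'I_n}) := odflt (Ordinal n0) [pick x | x \notin D].
have [|D DB /subsetP sfD] := @covering_card_le _ _ _ B (f @: B) tn covB.
  exact: leq_trans (leq_imset_card _ _) Bt.
have := sfD _ (imset_f f DB); rewrite /f; case: pickP => [x /negbTE->//|noD].
by have [x] := outside D DB; rewrite noD.
Qed.

(** The bound of [covering_card_gt] is attained by the complements of [t + 1]
    pairwise disjoint [k]-sets, as [t] points cannot meet all of these. *)
Lemma covering_number_disjoint (n k t : nat) :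
  0 < k -> t.+1 * k <= n -> covering_number n (n - k) t = t.+1.
Proof.
move=> k0 tkn.
have tn : t + k <= n by nia.
have prod_le : #|{: 'I_t.+1 * 'I_k}| <= n by rewrite card_prod !card_ord.
pose f (x : 'I_t.+1 * 'I_k) : 'I_n := widen_ord prod_le (enum_rank x).
have f_inj : injective f by move=> x y /(congr1 val) /= /val_inj/enum_rank_inj.
pose F j : {set 'I_n} := [set f (j, l) | l in 'I_k].
have cF j : #|F j| = k.
  by rewrite card_imset ?card_ord // => l l' /f_inj[].
pose B := [set ~: F j | j in 'I_t.+1].
have covB : is_covering (n - k) t B.
  apply/is_coveringP; split=> [_ /imsetP[j _ ->]|T cT].
    by rewrite cardsCs setCK card_ord cF.
  have [/existsP[j disj]|] := boolP [exists j, [disjoint T & F j]].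
    by exists (~: F j); [exact: imset_f | rewrite -disjoints_subset].
  rewrite negb_exists => /forallP meet; suff: t < #|T| by rewrite cT ltnn.
  (* If [T] meets each [F j], then the points of [T], seen as pairs, have all
     [t + 1] possible first components. *)
  have onto : [set x.1 | x in f @^-1: T] = [set: 'I_t.+1].
    apply/setP=> j; rewrite inE.
    have /pred0Pn[x /andP[/= xT /imsetP[l _ eqx]]] := meet j.
    by apply/imsetP; exists (j, l); rewrite ?inE -?eqx.
  rewrite -[t.+1]card_ord -cardsT -onto (leq_trans (leq_imset_card _ _)) //.
  rewrite -(card_imset _ f_inj) subset_leq_card //.
  by apply/subsetP=> _ /imsetP[x + ->]; rewrite inE.
have [|[B0 covB0 <-] minB] := @covering_number_min n (n - k) t; first lia.
have leB : #|B| <= t.+1.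
  by rewrite (leq_trans (leq_imset_card _ _)) // card_ord.
have gtB0 : t < #|B0| by apply: covering_card_gt covB0; lia.
by apply/eqP; rewrite eqn_leq gtB0 (leq_trans (minB _ covB)).
Qed.

(** * Kneser graphs *)

Section Kneser.

Variables n k : nat.
Implicit Types (A B C : kneser_vertex n k) (X : {set kneser_vertex n k}).
Let adj := @kneser_adj n k.

Lemma card_kneser_val A : #|val A| = k.
Proof. exact/eqP/(valP A). Qed.

Lemma kneser_vertexP (S : {set 'I_n}) : #|S| = k -> exists A, val A = S.
Proof. by move=> /eqP cS; exists (exist _ S cS). Qed.

Lemma card_kneser_vertex : #|{: kneser_vertex n k}| = 'C(n, k).
Proof. by rewrite card_sig -cardsE card_draws card_ord. Qed.

Lemma kneser_common_neighbour A B C :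
  (adj A C && adj C B) = (val A :|: val B \subset ~: val C).
Proof.
by rewrite /adj /kneser_adj subUset ![_ :&: _ == _]setI_eq0 (disjoint_sym (val C))
           !disjoints_subset.
Qed.

Lemma card_kneser_union A B : ~~ adj A B -> #|val A :|: val B| < k + k.
Proof.
rewrite /adj /kneser_adj -card_gt0.
by have := cardsUI (val A) (val B); rewrite !card_kneser_val; lia.
Qed.

(** Take a [k]-set [A] in [T], and a [k]-set [B] in [T] that contains [T :\: A];
    the latter is too small to be [B], so [B] meets [A]. *)
Lemma kneser_union (T : {set 'I_n}) : k < #|T| < k + k ->
  exists A B, [/\ A != B, ~~ adj A B & val A :|: val B = T].
Proof.
move=> /andP[kT Tk].
have [|SA [_ sAT cA]] := @exists_set_between _ set0 T k (sub0set T).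
  by rewrite cards0 leq0n ltnW.
have cTA : #|T :\: SA| = #|T| - k by rewrite cardsDS // cA.
have [|SB [sB sBT cB]] := @exists_set_between _ (T :\: SA) T k (subsetDl T SA).
  by rewrite cTA; lia.
have [A eqA] := kneser_vertexP cA; have [B eqB] := kneser_vertexP cB.
have UT : val A :|: val B = T.
  apply/eqP; rewrite eqEsubset eqA eqB subUset sAT sBT /=.
  apply/subsetP=> x xT; rewrite inE orbC -implyNb; apply/implyP=> xB.
  by apply: contraNT xB => xA; rewrite (subsetP sB) // inE xA.
exists A, B; split=> //.
  apply/eqP=> eqAB; move: kT.
  by rewrite -UT eqAB setUid card_kneser_val ltnn.
rewrite /adj /kneser_adj -card_gt0.
by have := cardsUI (val A) (val B); rewrite UT !card_kneser_val; lia.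
Qed.

(** ** The case [n <= 3k - 1] *)

(** Any vertex is the only common neighbour of two vertices whose union is its
    complement, so it lies inside every shortest path between them. *)
Lemma tmv_kneser_eq0 X : k + k < n < 3 * k ->
  total_mutual_visibility_set adj X -> X = set0.
Proof.
move=> nk tmv; apply/setP=> C; rewrite inE; apply/negP=> CX.
have [|A [B [neqAB nadj UC]]] := @kneser_union (~: val C).
  by rewrite cardsCs setCK card_ord card_kneser_val; lia.
have [|D [AD DB DX]] := (visible_dist2 X neqAB nadj _).1 (tmv A B).
  by exists C; rewrite kneser_common_neighbour UC.
move: (kneser_common_neighbour A B D); rewrite AD DB UC => /esym sCD.
suff eqDC : D = C by rewrite eqDC CX in DX.
apply/val_inj/eqP; rewrite eqEcard !card_kneser_val leqnn andbT.
by rewrite -setCS.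
Qed.

Lemma tmv_number_eq0 : k + k < n < 3 * k ->
  total_mutual_visibility_number adj = 0.
Proof.
move=> nk; apply/eqP; rewrite -leqn0; apply/bigmax_leqP=> X /asboolP.
by move=> /(tmv_kneser_eq0 nk)->; rewrite cards0.
Qed.

(** ** The case [n >= 3k - 1] *)

Lemma kneser_diameter2 A B : 3 * k - 1 <= n ->
  ~~ adj A B -> exists C, adj A C && adj C B.
Proof.
move=> nk /card_kneser_union cU.
have [|S [_ sS /kneser_vertexP[C eqC]]] :=
  @exists_set_between _ set0 (~: (val A :|: val B)) k (sub0set _).
  by rewrite cards0 cardsCs setCK card_ord; lia.
by exists C; rewrite kneser_common_neighbour -setCS setCK eqC.
Qed.

(** The blocks that [X] leaves available: as seen in
    [kneser_common_neighbour], the vertices outside [X] act through their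
    complements. *)
Definition kneser_blocks X : {set {set 'I_n}} := [set ~: val C | C in ~: X].

Lemma card_kneser_blocks X : #|X| + #|kneser_blocks X| = 'C(n, k).
Proof.
rewrite card_imset => [|A B /setC_inj/val_inj//].
by rewrite cardsC card_kneser_vertex.
Qed.

Lemma kneser_blocks_surj (B : {set {set 'I_n}}) : k <= n ->
  (forall D, D \in B -> #|D| = n - k) -> exists X, kneser_blocks X = B.
Proof.
move=> kn cB; exists [set C | ~: val C \notin B].
apply/setP=> D; apply/imsetP/idP=> [[C]|DB]; first by rewrite !inE negbK => ? ->.
have [|C eqC] := @kneser_vertexP (~: D).
  by rewrite cardsCs setCK card_ord cB //; lia.
by exists C; rewrite ?inE eqC setCK ?DB.
Qed.

Lemma tmv_covering X : 1 < k -> 3 * k - 1 <= n ->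
  total_mutual_visibility_set adj X <->
  is_covering (n - k) (2 * k - 1) (kneser_blocks X).
Proof.
move=> k1 nk.
rewrite tmv_diameter2 => [|A B _]; last exact: kneser_diameter2.
split=> [tmv|cov A B _ /card_kneser_union cU].
  apply/is_coveringP; split=> [_ /imsetP[C _ ->]|T cT].
    by rewrite cardsCs setCK card_ord card_kneser_val.
  have [|A [B [neqAB nadj <-]]] := @kneser_union T; first by rewrite cT; lia.
  have [C [AC CB CX]] := tmv A B neqAB nadj.
  exists (~: val C); first by apply/imsetP; exists C; rewrite ?inE.
  by rewrite -kneser_common_neighbour AC CB.
have [||_ /imsetP[C CX ->]] := covering_card_le (T := val A :|: val B) _ cov.
- by lia.
- by lia.
rewrite -kneser_common_neighbour => /andP[AC CB].
by exists C; split=> //; rewrite inE in CX.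
Qed.

Lemma tmv_number_covering : 1 < k -> 3 * k - 1 <= n ->
  total_mutual_visibility_number adj
  = 'C(n, k) - covering_number n (n - k) (2 * k - 1).
Proof.
move=> k1 nk.
have [|[B covB eqB] minB] := @covering_number_min n (n - k) (2 * k - 1); first lia.
apply/eqP; rewrite eqn_leq; apply/andP; split.
  apply/bigmax_leqP=> X /asboolP/(tmv_covering _ k1 nk)/minB.
  by have := card_kneser_blocks X; lia.
have [|X eqX] := @kneser_blocks_surj B _ (is_coveringP _ _ _ covB).1; first lia.
rewrite -eqB -eqX -(card_kneser_blocks X) addnK.
apply: leq_bigmax_cond; apply/asboolP/(tmv_covering _ k1 nk).
by rewrite eqX.
Qed.

End Kneser.

(** * The total mutual-visibility number *)

Theorem theorem4 (n k : nat) (hn : 2 * k + 1 <= n) (hk : 2 <= k) :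
  [/\ 2 * k + 1 <= n <= 3 * k - 1 ->
        total_mutual_visibility_number (@kneser_adj n k) = 0,
      3 * k <= n <= 2 * k ^ 2 - 1 ->
        total_mutual_visibility_number (@kneser_adj n k)
        = 'C(n, k) - covering_number n (n - k) (2 * k - 1)
    & 2 * k ^ 2 <= n ->
        total_mutual_visibility_number (@kneser_adj n k) = 'C(n, k) - 2 * k].
Proof.
split=> [nk|nk|nk].
- by apply: tmv_number_eq0; lia.
- by apply: tmv_number_covering; lia.
have nk3 : 3 * k - 1 <= n by rewrite expnS expn1 in nk; nia.
rewrite tmv_number_covering // covering_number_disjoint; first by congr (_ - _); lia.
  by lia.
by rewrite expnS expn1 in nk; nia.
Qed.
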